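(* For every $n \geq 2$ there is a problem that has an $n$-th root but no $(n+1)$-th root.
   Context: A problem is a partial multivalued function $f:\subseteq \mathbb{N}^\mathbb{N} \rightrightarrows \mathbb{N}^\mathbb{N}$; $\mathrm{dom}(f)$ is the set of $x$ with $f(x)\neq\emptyset$. Fix a standard computable pairing $\langle x,y\rangle$. $f \le_W g$ iff there are partial computable $h,k:\subseteq\mathbb{N}^\mathbb{N}\to\mathbb{N}^\mathbb{N}$ such that for every $x\in\mathrm{dom}(f)$, $k(x)\in\mathrm{dom}(g)$ and for every $y\in g(k(x))$, $h(\langle x,y\rangle)\in f(x)$; $f\equiv_W g$ means both directions. The composition $f\circ g$ has domain $\{x\in\mathrm{dom}(g) : g(x)\subseteq \mathrm{dom}(f)\}$ and $(f\circ g)(x)=\{z : \exists y\in g(x),\ z\in f(y)\}$. The compositional product $f*g$ is a $\le_W$-maximum of $\{f'\circ g' : f'\le_W f,\ g'\le_W g\}$ (exists, unique up to $\equiv_W$). $f^{[0]}:=\mathrm{id}$, $f^{[n]}$ is the compositional product of $n$ copies of $f$; for $n\ge 2$, $r$ is an $n$-th root of $f$ iff $f\equiv_W r^{[n]}$. *)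

(* Defs.v *)
From Stdlib Require Import Arith Cantor.

(** * Partial computable functions on Baire space *)

Definition baire := nat -> nat.

(** Programs for the partial functions [nat -> nat] that are recursive in an
    oracle [x].  All functions are unary: several arguments are packed into one
    by the Cantor pairing [to_nat], and the identity is [Pair Fst Snd]. *)
Inductive code : Set :=
| Zero | Succ | Fst | Snd
| Query
| Pair (c d : code)
| Comp (c d : code)
| Rec (c d : code)
| Mu (c : code).

(** [eval x c n v]: with oracle [x], program [c] halts on input [n] with
    output [v]. *)
Inductive eval (x : baire) : code -> nat -> nat -> Prop :=
| eval_zero n : eval x Zero n 0
| eval_succ n : eval x Succ n (S n)
| eval_fst n : eval x Fst n (fst (of_nat n))
| eval_snd n : eval x Snd n (snd (of_nat n))
| eval_query n : eval x Query n (x n)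
| eval_pair c d n a b :
    eval x c n a -> eval x d n b -> eval x (Pair c d) n (to_nat (a, b))
| eval_comp c d n a b :
    eval x d n a -> eval x c a b -> eval x (Comp c d) n b
| eval_rec_O c d a v :
    eval x c a v -> eval x (Rec c d) (to_nat (a, 0)) v
| eval_rec_S c d a k u v :
    eval x (Rec c d) (to_nat (a, k)) u ->
    eval x d (to_nat (a, to_nat (k, u))) v ->
    eval x (Rec c d) (to_nat (a, S k)) v
| eval_mu c n k (w : nat -> nat) :
    (* [w] lists the predecessors of the values below [k], so that [k] is the
       first zero and all earlier computations halt *)
    (forall j, j < k -> eval x c (to_nat (n, j)) (S (w j))) ->
    eval x c (to_nat (n, k)) 0 ->
    eval x (Mu c) n k.

Definition computes (c : code) (x y : baire) : Prop :=
  forall n, eval x c n (y n).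

(** A problem, i.e. a partial multivalued function on Baire space; [f x y] is
    read as [y] being in [f(x)]. *)
Definition problem := baire -> baire -> Prop.

Definition dom (f : problem) (x : baire) : Prop := exists y, f x y.

Definition single_valued (F : problem) : Prop :=
  forall x y y', F x y -> F x y' -> y = y'.

(** The program has to be correct on the domain of [F]; outside of it, its
    behaviour is unconstrained. *)
Definition partial_computable (F : problem) : Prop :=
  single_valued F /\ exists c, forall x y, F x y -> computes c x y.

(** * Weihrauch reducibility *)

(** The pairing of Baire space that interleaves [x] and [y]. *)
Definition bpair (x y : baire) : baire :=
  fun n => if Nat.even n then x (Nat.div2 n) else y (Nat.div2 n).

Definition leW (f g : problem) : Prop :=
  exists h k : problem, partial_computable h /\ partial_computable k /\
    forall x, dom f x ->
      exists z, k x z /\ dom g z /\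
        forall y, g z y -> exists w, h (bpair x y) w /\ f x w.

Definition eqW (f g : problem) : Prop := leW f g /\ leW g f.

(** * Compositional products, powers and roots *)

Definition compose (f g : problem) : problem :=
  fun x z => (forall y, g x y -> dom f y) /\ exists y, g x y /\ f y z.

Definition composite_below (f g p : problem) : Prop :=
  exists f' g', leW f' f /\ leW g' g /\ p = compose f' g'.

(** The compositional product is only determined up to [eqW], so it is a
    relation: [p] represents [f * g]. *)
Definition is_comp_prod (f g p : problem) : Prop :=
  composite_below f g p /\ forall q, composite_below f g q -> leW q p.

Definition idB : problem := fun x y => y = x.

(** [p] represents the compositional product of [n] copies of [f]. *)
Fixpoint is_power (f : problem) (n : nat) (p : problem) : Prop :=
  match n with
  | 0 => p = idB
  | 1 => p = f
  | S m => exists q, is_power f m q /\ is_comp_prod f q p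
  end.

Definition is_root (n : nat) (r f : problem) : Prop :=
  exists p, is_power r n p /\ eqW f p.

Definition has_root (n : nat) (f : problem) : Prop :=
  exists r, is_root n r f.

(* Main.v *)
Require Import Defs.
From Stdlib Require Import Arith Lia Bool Cantor.
From Stdlib Require Import ClassicalEpsilon FunctionalExtensionality PropExtensionality.

(* The witness is the n-th power of a variant [Hit] of LPO.  Suppose that it is
   equivalent to s^[n+1].  Then s^[n+1] has an LPO-like discontinuity.  Such a
   discontinuity of a composition is inherited by one of the factors, so s has
   one too.  Binary search with n+1 calls of s then finds the value of a counter
   that may increase up to 2^(n+1) - 1 times, relative to an oracle which is
   made part of the instances.  But n calls of [Hit] have at most 2^n possible
   answers, ordered so that the answer can only increase near an instance, and
   so they cannot follow 2^(n+1) - 1 increases. *)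

Local Opaque to_nat of_nat.

(** * Oracle programs *)

Definition agree (N : nat) (x y : baire) : Prop := forall i, i < N -> x i = y i.

Lemma agree_le M N x y : N <= M -> agree M x y -> agree N x y.
Proof. intros H Ha i Hi. apply Ha. lia. Qed.

(** A halting computation makes finitely many queries. For [Mu], the bounds of the finitely many
    earlier computations are merged by an inner induction. *)
Lemma eval_use x c n v :
  eval x c n v -> exists N, forall x', agree N x' x -> eval x' c n v.
Proof.
  induction 1 as [n|n|n|n|n|c d n a b _ [N1 H1] _ [N2 H2]
    |c d n a b _ [N1 H1] _ [N2 H2]|c d a v _ [N H]
    |c d a k u v _ [N1 H1] _ [N2 H2]|c n k w _ IH _ [N H]].
  1-4: exists 0; intros; constructor.
  - exists (S n). intros x' Ha. rewrite <- (Ha n) by lia. constructor.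
  - exists (max N1 N2). intros x' Ha.
    constructor; [apply H1 | apply H2]; (eapply agree_le; [|exact Ha]; lia).
  - exists (max N1 N2). intros x' Ha.
    econstructor; [apply H1 | apply H2]; (eapply agree_le; [|exact Ha]; lia).
  - exists N. intros x' Ha. constructor; auto.
  - exists (max N1 N2). intros x' Ha.
    econstructor; [apply H1 | apply H2]; (eapply agree_le; [|exact Ha]; lia).
  - assert (Hk : forall k', k' <= k -> exists N', forall x', agree N' x' x ->
              forall j, j < k' -> eval x' c (to_nat (n, j)) (S (w j))).
    { induction k' as [|k' IHk]; intros Hk'.
      - exists 0. intros. lia.
      - destruct IHk as [N1 H1]; [lia|]. destruct (IH k') as [N2 H2]; [lia|].
        exists (max N1 N2). intros x' Ha j Hj.
        destruct (Nat.eq_dec j k') as [->|].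
        + apply H2. eapply agree_le; [|exact Ha]; lia.
        + apply H1; [eapply agree_le; [|exact Ha]; lia | lia]. }
    destruct (Hk k (le_n k)) as [N' H']. exists (max N N'). intros x' Ha.
    apply eval_mu with w.
    + apply H'. eapply agree_le; [|exact Ha]; lia.
    + apply H. eapply agree_le; [|exact Ha]; lia.
Qed.

Lemma eval_rec_inv x c d m v : eval x (Rec c d) m v ->
  (exists a, m = to_nat (a, 0) /\ eval x c a v) \/
  (exists a k u, m = to_nat (a, S k) /\ eval x (Rec c d) (to_nat (a, k)) u /\
     eval x d (to_nat (a, to_nat (k, u))) v).
Proof.
  remember (Rec c d) as e eqn:E. destruct 1; try discriminate; injection E as -> ->.
  - left. eauto.
  - right. eauto 6.
Qed.

Lemma eval_det x c n v : eval x c n v -> forall v', eval x c n v' -> v = v'.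
Proof.
  induction 1 as [n|n|n|n|n|c d n a b _ H1 _ H2|c d n a b _ H1 _ H2|c d a v _ H1
    |c d a k u v _ H1 _ H2|c n k w Hw IH H0 IH0]; intros v' Hv'.
  1-5: inversion Hv'; reflexivity.
  - inversion Hv'; subst. f_equal. f_equal; auto.
  - inversion Hv'; subst. match goal with H : eval _ d _ _ |- _ => apply H1 in H end.
    subst. auto.
  - apply eval_rec_inv in Hv' as [(a' & E & H)|(a' & k & u & E & _)];
      apply to_nat_inj in E; inversion E; subst; auto.
  - apply eval_rec_inv in Hv' as [(a' & E & _)|(a' & k' & u' & E & Hu & Hv)];
      apply to_nat_inj in E; inversion E; subst.
    apply H1 in Hu. subst. auto.
  - inversion Hv' as [| | | | | | | | |c' n' k' w' Hw' H0']; subst.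
    destruct (lt_eq_lt_dec k v') as [[Hlt|Heq]|Hlt]; auto.
    + specialize (IH0 _ (Hw' _ Hlt)). discriminate.
    + specialize (IH _ Hlt _ H0'). discriminate.
Qed.

Lemma computes_det c x y y' : computes c x y -> computes c x y' -> y = y'.
Proof.
  intros H H'. apply functional_extensionality. intros n.
  exact (eval_det _ _ _ _ (H n) _ (H' n)).
Qed.

Lemma computes_continuous c x y : computes c x y -> forall N, exists M,
  forall x' y', computes c x' y' -> agree M x' x -> agree N y' y.
Proof.
  intros H N. induction N as [|N [M IH]].
  - exists 0. intros x' y' _ _ i Hi. lia.
  - destruct (eval_use _ _ _ _ (H N)) as [M' H']. exists (max M M').
    intros x' y' Hc Ha i Hi. destruct (Nat.eq_dec i N) as [->|].
    + apply (eval_det x' c N); auto. apply H'. eapply agree_le; [|exact Ha]; lia.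
    + apply (IH x'); auto; [eapply agree_le; [|exact Ha]; lia | lia].
Qed.

Lemma partial_computable_computes c : partial_computable (computes c).
Proof. split; [intros x y y'; apply computes_det | exists c; auto]. Qed.

(** * Programs for case distinction, halving and interleaving *)

Lemma eval_fst_pair x a b : eval x Fst (to_nat (a, b)) a.
Proof. generalize (eval_fst x (to_nat (a, b))). now rewrite cancel_of_to. Qed.

Lemma eval_snd_pair x a b : eval x Snd (to_nat (a, b)) b.
Proof. generalize (eval_snd x (to_nat (a, b))). now rewrite cancel_of_to. Qed.

Definition cid : code := Pair Fst Snd.

Lemma eval_id x n : eval x cid n n.
Proof.
  rewrite <- (cancel_to_of n) at 2. rewrite (surjective_pairing (of_nat n)).
  repeat constructor.
Qed.

Fixpoint cconst (m : nat) : code :=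
  match m with 0 => Zero | S m => Comp Succ (cconst m) end.

Lemma eval_const x m n : eval x (cconst m) n m.
Proof.
  induction m as [|m IH]; simpl; [constructor|]. econstructor; eauto using eval.
Qed.

Fixpoint cadd (m : nat) : code :=
  match m with 0 => cid | S m => Comp Succ (cadd m) end.

Lemma eval_add x m n : eval x (cadd m) n (n + m).
Proof.
  induction m as [|m IH]; simpl.
  - rewrite Nat.add_0_r. apply eval_id.
  - rewrite Nat.add_succ_r. econstructor; eauto using eval.
Qed.

(** A recursion of length at most one on the value of the test [t]. The branch [c] is its base case
    and so must halt even when [d] is selected. *)
Definition cif (t c d : code) : code :=
  Comp (Rec c (Comp d Fst)) (Pair cid t).

Lemma eval_if x t c d n b u v :
  eval x t n b -> b <= 1 -> eval x c n u -> eval x d n v ->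
  eval x (cif t c d) n (if b =? 0 then u else v).
Proof.
  intros Ht Hb Hc Hd. eapply eval_comp.
  - apply eval_pair; [apply eval_id | exact Ht].
  - destruct b as [|[|b]]; [| |lia]; simpl.
    + now constructor.
    + econstructor; [now constructor; apply Hc|].
      econstructor; [apply eval_fst_pair | exact Hd].
Qed.

(** Recursion that carries quotient and parity together; these are the data by which [bpair] is
    defined. *)
Definition chalf : code :=
  Comp (Rec Zero (Comp (cif Snd (Pair Fst (cconst 1)) (Pair (Comp Succ Fst) Zero))
                       (Comp Snd Snd)))
       (Pair Zero cid).

Lemma eval_half x n :
  eval x chalf n (to_nat (Nat.div2 n, if Nat.even n then 0 else 1)).
Proof.
  eapply eval_comp; [apply eval_pair; [apply eval_zero | apply eval_id]|].
  induction n as [|n IH]; [exact (eval_rec_O _ _ _ _ _ (eval_zero x 0))|].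
  eapply eval_rec_S; [exact IH|].
  eapply eval_comp; [eapply eval_comp; [apply eval_snd_pair | apply eval_snd_pair]|].
  assert (E : to_nat (Nat.div2 (S n), if Nat.even (S n) then 0 else 1) =
    if (if Nat.even n then 0 else 1) =? 0 then to_nat (Nat.div2 n, 1)
    else to_nat (S (Nat.div2 n), 0)).
  { destruct (Nat.Even_or_Odd n) as [He|Ho].
    - rewrite (Nat.Even_div2 _ He). rewrite Nat.even_succ, <- Nat.negb_even.
      apply Nat.even_spec in He. now rewrite He.
    - rewrite (Nat.Odd_div2 _ Ho). rewrite Nat.even_succ, <- Nat.negb_even.
      apply Nat.odd_spec in Ho. rewrite <- Nat.negb_even in Ho.
      now destruct (Nat.even n). }
  rewrite E. apply eval_if.
  - apply eval_snd_pair.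
  - destruct (Nat.even n); lia.
  - apply eval_pair; [apply eval_fst_pair | apply eval_const].
  - apply eval_pair; [|apply eval_zero].
    eapply eval_comp; [apply eval_fst_pair | apply eval_succ].
Qed.

Definition cbpair (c d : code) : code :=
  Comp (cif Snd (Comp c Fst) (Comp d Fst)) chalf.

Lemma computes_bpair c d x u v :
  computes c x u -> computes d x v -> computes (cbpair c d) x (bpair u v).
Proof.
  intros Hc Hd n. eapply eval_comp; [apply eval_half|].
  assert (E : bpair u v n = if (if Nat.even n then 0 else 1) =? 0
    then u (Nat.div2 n) else v (Nat.div2 n)).
  { unfold bpair. now destruct (Nat.even n). }
  rewrite E. apply eval_if.
  - apply eval_snd_pair.
  - destruct (Nat.even n); lia.
  - eapply eval_comp; [apply eval_fst_pair | apply Hc].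
  - eapply eval_comp; [apply eval_fst_pair | apply Hd].
Qed.

Definition cdouble : code :=
  Comp (Rec Zero (Comp Succ (Comp Succ (Comp Snd Snd)))) (Pair Zero cid).

Lemma eval_double x n : eval x cdouble n (2 * n).
Proof.
  eapply eval_comp; [apply eval_pair; [apply eval_zero | apply eval_id]|].
  induction n as [|n IH]; [exact (eval_rec_O _ _ _ _ _ (eval_zero x 0))|].
  eapply eval_rec_S; [exact IH|].
  replace (2 * S n) with (S (S (2 * n))) by lia.
  eapply eval_comp; [|apply eval_succ]. eapply eval_comp; [|apply eval_succ].
  eapply eval_comp; apply eval_snd_pair.
Qed.

Lemma bpair_even x y n : bpair x y (2 * n) = x n.
Proof. unfold bpair. rewrite Nat.even_even, Nat.div2_double. reflexivity. Qed.

Lemma bpair_odd x y n : bpair x y (S (2 * n)) = y n.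
Proof.
  unfold bpair. rewrite Nat.div2_succ_double, Nat.even_succ, <- Nat.negb_even.
  now rewrite Nat.even_even.
Qed.

Lemma bpair_inj x y x' y' : bpair x y = bpair x' y' -> x = x' /\ y = y'.
Proof.
  intros H. split; apply functional_extensionality; intros n.
  - rewrite <- (bpair_even x y n), H. apply bpair_even.
  - rewrite <- (bpair_odd x y n), H. apply bpair_odd.
Qed.

Lemma agree_bpair N x y x' y' :
  agree N x x' -> agree N y y' -> agree N (bpair x y) (bpair x' y').
Proof.
  intros H H' i Hi. assert (Nat.div2 i < N).
  { destruct i as [|i]; [exact Hi|]. pose proof (Nat.lt_div2 (S i)). lia. }
  unfold bpair. destruct (Nat.even i); auto.
Qed.

Definition cleft : code := Comp Query cdouble.
Definition cright : code := Comp Query (Comp Succ cdouble).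

Lemma computes_left x y : computes cleft (bpair x y) x.
Proof.
  intros n. eapply eval_comp; [apply eval_double|].
  rewrite <- (bpair_even x y n). apply eval_query.
Qed.

Lemma computes_right x y : computes cright (bpair x y) y.
Proof.
  intros n. eapply eval_comp; [eapply eval_comp; [apply eval_double | apply eval_succ]|].
  rewrite <- (bpair_odd x y n). apply eval_query.
Qed.

Lemma computes_query x : computes Query x x.
Proof. intros n. apply eval_query. Qed.

Lemma computes_const x m : computes (cconst m) x (fun _ => m).
Proof. intros n. apply eval_const. Qed.

(** Composition of functionals on Baire space, first [d] and then [c], whereas [Comp] composes
    functions on numbers over one fixed oracle. *)
Fixpoint csubst (d c : code) : code :=
  match c with
  | Query => d
  | Pair c1 c2 => Pair (csubst d c1) (csubst d c2)
  | Comp c1 c2 => Comp (csubst d c1) (csubst d c2)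
  | Rec c1 c2 => Rec (csubst d c1) (csubst d c2)
  | Mu c1 => Mu (csubst d c1)
  | c => c
  end.

Lemma eval_subst d x y c n v :
  computes d x y -> eval y c n v -> eval x (csubst d c) n v.
Proof. intros Hd. induction 1; simpl; eauto using eval. Qed.

Lemma computes_subst c d x y z :
  computes d x y -> computes c y z -> computes (csubst d c) x z.
Proof. intros Hd Hc n. eapply eval_subst; eauto. Qed.

(** The function computed by a program is itself partial computable, so [h] and [k] may be taken to
    be everything that their programs compute. *)
Lemma leW_codes f g : leW f g <-> exists ch ck, forall x, dom f x ->
  exists z, computes ck x z /\ dom g z /\
    forall y, g z y -> exists w, computes ch (bpair x y) w /\ f x w.
Proof.
  split.
  - intros (h & k & [_ [ch Hch]] & [_ [ck Hck]] & H). exists ch, ck. intros x Hx.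
    destruct (H x Hx) as (z & Hz & Hd & Hy). exists z. repeat split; auto.
    intros y Hgy. destruct (Hy y Hgy) as (w & Hw & Hf). eauto.
  - intros (ch & ck & H). exists (computes ch), (computes ck).
    split; [apply partial_computable_computes|].
    split; [apply partial_computable_computes|]. exact H.
Qed.

Lemma leW_refl f : leW f f.
Proof.
  apply leW_codes. exists cright, Query. intros x Hx.
  exists x. split; [apply computes_query|]. split; [exact Hx|].
  intros y Hy. exists y. split; [apply computes_right | exact Hy].
Qed.

(** * Discontinuity *)

(* [A] is a base of a filter converging to [a] along which [f] is discontinuous
   at [a] in the strong sense that no solution at [a] is a limit of solutions.
   This is a topological version of LPO being reducible to [f]. *)
Definition jumps (f : problem) : Prop :=
  exists (a : baire) (A : nat -> baire -> Prop),
    dom f a /\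
    (forall N, exists b, A N b) /\
    (forall M N b, M <= N -> A N b -> A M b) /\
    (forall N b, A N b -> dom f b /\ agree N b a) /\
    (forall y, f a y -> exists N, forall b y', A N b -> f b y' -> ~ agree N y' y).

(** The filter is pushed forward along [ck]. If solutions of [g] approached a solution at [z],
    continuity of [ch] would make solutions of [f] approach one at [a]. *)
Lemma jumps_leW f g : leW f g -> jumps f -> jumps g.
Proof.
  rewrite leW_codes. intros (ch & ck & Hred) (a & A & Ha & Hne & Hdec & Hlim & Hsep).
  destruct (Hred a Ha) as (z & Hz & Hdz & Hsol).
  exists z, (fun N u => exists b, A N b /\ computes ck b u /\ dom g u /\ agree N u z /\
    forall y, g u y -> exists w, computes ch (bpair b y) w /\ f b w).
  split; [exact Hdz|]. split; [|split; [|split]].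
  - intros N. destruct (computes_continuous _ _ _ Hz N) as [M HM].
    destruct (Hne (max M N)) as [b Hb]. destruct (Hlim _ _ Hb) as [Hdb Hab].
    destruct (Hred b Hdb) as (u & Hu & Hdu & Hsu). exists u, b.
    split; [apply (Hdec N (max M N)); auto; lia|]. repeat split; auto.
    apply (HM b); auto. eapply agree_le; [|exact Hab]; lia.
  - intros M N u HMN (b & Hb & Hu & Hdu & Hau & Hs). exists b.
    split; [eauto|]. repeat split; auto. eapply agree_le; [|exact Hau]; lia.
  - intros N u (b & Hb & Hu & Hdu & Hau & Hs). auto.
  - intros y Hy. destruct (Hsol y Hy) as (w & Hw & Hfw).
    destruct (Hsep w Hfw) as [N HN].
    destruct (computes_continuous _ _ _ Hw N) as [M HM].
    exists (max M N). intros u y' (b & Hb & Hu & Hdu & Hau & Hs) Hy' Hag.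
    destruct (Hs y' Hy') as (w' & Hw' & Hfw').
    apply (HN b w'); auto; [apply (Hdec N (max M N)); auto; lia|].
    apply (HM (bpair b y')); auto. apply agree_le with (max M N); [lia|].
    apply agree_bpair; auto. now apply Hlim.
Qed.

(** If [g] does not jump along the given filter, some solution [y] of [g] at [a] is a limit of
    solutions of [g] at nearby points. These solutions form a filter along which [f] jumps at
    [y]. *)
Lemma jumps_compose f g : jumps (compose f g) -> jumps f \/ jumps g.
Proof.
  intros (a & A & Ha & Hne & Hdec & Hlim & Hsep).
  assert (Hdg : forall b, dom (compose f g) b -> dom g b /\ forall y, g b y -> dom f y).
  { intros b (z & Hd & y & Hy & _). split; [now exists y | exact Hd]. }
  destruct (classic (jumps g)) as [Hg|Hg]; [now right | left].
  assert (exists y, g a y /\ forall N, exists b y', A N b /\ g b y' /\ agree N y' y)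
    as (y & Hy & Hclose).
  { apply NNPP. intros Hno. apply Hg. exists a, A. split; [now apply Hdg|].
    split; [exact Hne|]. split; [exact Hdec|].
    split; [intros N b Hb; apply Hlim in Hb as [Hb ?]; split; auto; now apply Hdg|].
    intros y Hy. apply NNPP. intros HN. apply Hno. exists y. split; [exact Hy|].
    intros N. apply NNPP. intros Hb. apply HN. exists N. intros b y' HA Hgb Hag.
    apply Hb. eauto. }
  exists y, (fun N u => exists b, A N b /\ g b u /\ agree N u y).
  split; [now apply (Hdg a)|]. split; [|split; [|split]].
  - intros N. destruct (Hclose N) as (b & y' & H). eauto.
  - intros M N u HMN (b & Hb & Hu & Hau). exists b. repeat split; eauto.
    eapply agree_le; eauto.
  - intros N u (b & Hb & Hu & Hau). apply Hlim in Hb as [Hb _].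
    split; [now apply (Hdg b) | exact Hau].
  - intros z Hz. destruct (Hsep z) as [N HN].
    { split; [now apply Hdg | eauto]. }
    exists N. intros u z' (b & Hb & Hu & Hau) Hz'. apply (HN b z' Hb).
    split; [apply Hdg; now apply Hlim in Hb | eauto].
Qed.

Lemma jumps_power s m p : is_power s (S m) p -> jumps p -> jumps s.
Proof.
  revert p. induction m as [|m IH]; intros p Hp Hj.
  - now simpl in Hp; subst.
  - destruct Hp as (q & Hq & (f' & g' & Hf & Hg & ->) & _).
    apply jumps_compose in Hj as [Hj|Hj]; eauto using jumps_leW.
Qed.

(** * Counting mind changes *)

(* [R x c y] selects a solution [y] together with a counter [c < K] that can
   only increase near [x]; where it does not, the solution varies
   continuously. *)
Definition ranked (K : nat) (f : problem) : Prop :=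
  exists R : baire -> nat -> baire -> Prop,
    (forall x, dom f x -> exists c y, R x c y) /\
    (forall x c y, R x c y -> c < K /\ f x y) /\
    (forall x c y, R x c y -> forall N, exists M, forall x' c' y',
       R x' c' y' -> agree M x' x -> c <= c' /\ (c' = c -> agree N y' y)).

Lemma ranked_leW K f g : leW f g -> ranked K g -> ranked K f.
Proof.
  rewrite leW_codes. intros (ch & ck & Hred) (R & Hex & Hin & Hc).
  exists (fun x c w => exists z y, computes ck x z /\ R z c y /\
    computes ch (bpair x y) w /\ f x w).
  split; [|split].
  - intros x Hx. destruct (Hred x Hx) as (z & Hz & Hd & Hs).
    destruct (Hex z Hd) as (c & y & HR). destruct (Hs y) as (w & Hw & Hf).
    { now apply (Hin z c). }
    exists c, w, z, y. auto.
  - intros x c w (z & y & Hz & HR & Hw & Hf). split; auto. now apply (Hin z c y).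
  - intros x c w (z & y & Hz & HR & Hw & Hf) N.
    destruct (computes_continuous _ _ _ Hw N) as [M1 H1].
    destruct (Hc _ _ _ HR M1) as [M2 H2].
    destruct (computes_continuous _ _ _ Hz M2) as [M3 H3].
    exists (max M1 M3). intros x' c' w' (z' & y' & Hz' & HR' & Hw' & Hf') Hag.
    destruct (H2 z' c' y' HR') as [Hle Heq].
    { apply (H3 x'); auto. eapply agree_le; [|exact Hag]; lia. }
    split; [exact Hle|]. intros E. apply (H1 (bpair x' y')); auto.
    apply agree_bpair; auto. eapply agree_le; [|exact Hag]; lia.
Qed.

(* The counter of the composition is lexicographic, that of [g] first. *)
Lemma ranked_compose K L f g :
  ranked K f -> ranked L g -> ranked (K * L) (compose f g).
Proof.
  intros (R & Rex & Rin & Rc) (Q & Qex & Qin & Qc).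
  exists (fun x c z => exists d y e, Q x d y /\ R y e z /\ c = d * K + e /\
    forall y, g x y -> dom f y).
  split; [|split].
  - intros x (z & Hd & y & Hy & _). destruct (Qex x) as (d & y' & HQ); [now exists y|].
    destruct (Rex y') as (e & z' & HR); [apply Hd; now apply (Qin x d)|].
    exists (d * K + e), z', d, y', e. auto.
  - intros x c z (d & y & e & HQ & HR & -> & Hd).
    apply Qin in HQ as [Hlt HQ]. apply Rin in HR as [Hlt' HR].
    split; [nia|]. split; eauto.
  - intros x c z (d & y & e & HQ & HR & -> & Hd) N.
    destruct (Rc _ _ _ HR N) as [M1 H1]. destruct (Qc _ _ _ HQ M1) as [M2 H2].
    exists M2. intros x' c' z' (d' & y' & e' & HQ' & HR' & -> & Hd') Hag.
    destruct (H2 _ _ _ HQ' Hag) as [Hle Heq].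
    apply Rin in HR as [Hlt _]. pose proof (Rin _ _ _ HR') as [Hlt' _].
    destruct (Nat.eq_dec d' d) as [->|Hne].
    + destruct (H1 _ _ _ HR' (Heq eq_refl)) as [Hle' Heq'].
      split; [lia|]. intros E. apply Heq'. lia.
    (* As [e < K], an increase of [d] raises the whole counter, however small [e'] is. *)
    + split; [nia|]. intros E. assert (d < d') by lia. nia.
Qed.

Lemma ranked_power K r m p :
  ranked K r -> is_power r (S m) p -> ranked (K ^ S m) p.
Proof.
  intros Hr. revert p. induction m as [|m IH]; intros p Hp.
  - simpl in Hp; subst. now rewrite Nat.pow_1_r.
  - destruct Hp as (q & Hq & (f' & g' & Hf & Hg & ->) & _).
    apply ranked_compose; eauto using ranked_leW.
Qed.

(** * A problem whose powers exist *)

Fixpoint encode (c : code) : nat :=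
  match c with
  | Zero => to_nat (0, 0)
  | Succ => to_nat (1, 0)
  | Fst => to_nat (2, 0)
  | Snd => to_nat (3, 0)
  | Query => to_nat (4, 0)
  | Pair c d => to_nat (5, to_nat (encode c, encode d))
  | Comp c d => to_nat (6, to_nat (encode c, encode d))
  | Rec c d => to_nat (7, to_nat (encode c, encode d))
  | Mu c => to_nat (8, encode c)
  end.

Lemma encode_inj c d : encode c = encode d -> c = d.
Proof.
  revert d. induction c; intros [] E; simpl in E; apply to_nat_inj in E;
    try discriminate E; try reflexivity; injection E; intros E';
    try apply to_nat_inj in E'; try (injection E'; intros); f_equal; auto.
Qed.

(* LPO, except that an instance [w] may instead name a program that computes
   another instance from [w].  This spares a universal machine: the instance
   computed by one program can name a further program. *)
Inductive hit : baire -> nat -> Prop :=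
| hit_never w : (forall k, w k = 0) -> hit w 0
| hit_at w k : w 0 = 0 -> w k <> 0 -> hit w 1
| hit_run w c w' b : w 0 = S (encode c) -> computes c w w' -> hit w' b -> hit w b.

Definition Hit : problem := fun w y => exists b, hit w b /\ y = fun _ => b.

Lemma hit_run_inv w c w' b :
  w 0 = S (encode c) -> computes c w w' -> hit w b -> hit w' b.
Proof.
  intros Hw Hc H. destruct H as [w H|w k H _|w d w'' b E Hd H].
  - rewrite H in Hw. discriminate.
  - rewrite H in Hw. discriminate.
  - rewrite E in Hw. injection Hw as Hw. apply encode_inj in Hw as ->.
    now rewrite (computes_det _ _ _ _ Hc Hd).
Qed.

Lemma hit_det w b b' : hit w b -> hit w b' -> b = b'.
Proof.
  intros H. revert b'. induction H as [w H|w k H Hk|w c w' b E Hc H IH];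
    intros b' H'.
  - destruct H' as [w _|w k _ Hk|w c w' b E _ _]; auto.
    + now rewrite H in Hk.
    + rewrite H in E. discriminate.
  - destruct H' as [w H'|w k' _ _|w c w' b E _ _]; auto.
    + now rewrite H' in Hk.
    + rewrite H in E. discriminate.
  - apply IH. eapply hit_run_inv; eauto.
Qed.

Lemma hit_le w b : hit w b -> b < 2.
Proof. induction 1; lia. Qed.

(** Answer 1 rests on one nonzero entry, reached through finitely many program runs. Nearby
    instances share the tags and, by continuity of the programs, that entry. *)
Lemma hit_semicontinuous w b : hit w b ->
  exists M, forall w' b', hit w' b' -> agree M w' w -> b <= b'.
Proof.
  induction 1 as [w H|w k H Hk|w c v b E Hc H [M IH]].
  - exists 0. intros. lia.
  - exists (S k). intros w' b' H' Hag. destruct H' as [w' H'|w' k' _ _|w' c v b' E _ _].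
    + rewrite <- Hag in Hk by lia. now rewrite H' in Hk.
    + lia.
    + rewrite <- Hag in H by lia. rewrite H in E. discriminate.
  - destruct (computes_continuous _ _ _ Hc M) as [M' HM'].
    exists (S M'). intros w' b' H' Hag.
    assert (E' : w' 0 = S (encode c)) by (rewrite <- E; apply Hag; lia).
    destruct H' as [w' H'|w' k' H' _|w' c' v' b' E'' Hc' H'].
    + rewrite H' in E'. discriminate.
    + rewrite H' in E'. discriminate.
    + rewrite E'' in E'. injection E' as E'. apply encode_inj in E' as ->.
      apply (IH v' b' H'). apply (HM' w'); auto. eapply agree_le; [|exact Hag]; lia.
Qed.

Lemma ranked_Hit : ranked 2 Hit.
Proof.
  exists (fun w b y => hit w b /\ y = fun _ => b). split; [|split].
  - intros w (y & b & H). eauto.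
  - intros w b y [H E]. split; [now apply (hit_le w) | now exists b].
  - intros w b y [H ->] N. destruct (hit_semicontinuous w b H) as [M HM].
    exists M. intros w' b' y' [H' ->] Hag. split; [eauto|]. intros -> i Hi. reflexivity.
Qed.

Lemma jumps_Hit : jumps Hit.
Proof.
  exists (fun _ => 0),
    (* The strict inequality keeps position 0 free, so that these instances are not read as naming a
       program. *)
    (fun N w => exists k, N < k /\ w = fun i => if i =? k then 1 else 0).
  assert (Hk : forall k, hit (fun i => if i =? S k then 1 else 0) 1).
  { intros k. apply hit_at with (S k); [reflexivity|]. now rewrite Nat.eqb_refl. }
  split; [|split; [|split; [|split]]].
  - exists (fun _ => 0), 0. split; [now constructor | reflexivity].
  - intros N. eexists. exists (S N). split; [lia | reflexivity].
  - intros M N b HMN (k & Hlt & ->). exists k. split; [lia | reflexivity].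
  - intros N b (k & Hlt & ->). split.
    + exists (fun _ => 1), 1. destruct k; [lia|]. auto.
    + intros i Hi. destruct (Nat.eqb_spec i k); lia.
  - intros y (b & Hb & ->). exists 1. intros w y' (k & Hlt & ->) (b' & Hb' & ->) Hag.
    specialize (Hag 0 (le_n 1)). simpl in Hag. subst b'.
    rewrite (hit_det _ _ 0 Hb) in Hb' by now constructor.
    destruct k as [|k]; [lia|].
    discriminate (hit_det _ _ _ (Hk k) Hb').
Qed.

(* Compositional products with [Hit] *)
Create HintDb computes.
Hint Resolve computes_subst computes_bpair computes_left computes_right
  computes_query computes_const : computes.

(** In the maximum, [g'] solves [v] by [g] and passes on a tag [t] and extra data [o]. Its whole
    output is then an instance of [Hit], whose tag names the program that computes the actual query
    from [o] and the solution of [v]. [f'] keeps its instance, so that the final answer can be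
    decoded. *)
Lemma comp_prod_Hit_exists g : exists p, is_comp_prod Hit g p.
Proof.
  set (f' := fun z u => exists y, Hit z y /\ u = bpair z y : Prop).
  set (g' := fun x z => exists t o v y,
    x = bpair t (bpair o v) /\ g v y /\ z = bpair x y : Prop).
  exists (compose f' g'). split.
  - exists f', g'. split; [|split; [|reflexivity]]; apply leW_codes.
    + exists Query, Query. intros z (u & y & Hy & ->).
      exists z. split; [apply computes_query|]. split; [now exists y|].
      intros y' Hy'. exists (bpair z y'). split; [apply computes_query | now exists y'].
    + exists Query, (csubst cright cright). intros x (z & t & o & v & y & -> & Hy & ->).
      exists v. split; [eauto with computes|]. split; [now exists y|].
      intros y' Hy'. eexists. split; [apply computes_query | exists t, o, v, y'; auto].
  - intros q (f'' & g'' & Hf & Hg & ->).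
    apply leW_codes in Hf as (h1 & k1 & Hf). apply leW_codes in Hg as (h2 & k2 & Hg).
    (* [A] recovers the input of [h2] from the output of [g'], [c] continues to the query of [Hit],
       and [B] prepares the input of [h1]. *)
    set (A := cbpair (csubst (csubst cleft cright) cleft) cright).
    set (c := csubst (csubst A h2) k1).
    set (B := cbpair (csubst (csubst (csubst cright cleft) A) h2) (csubst cright cright)).
    apply leW_codes.
    exists (csubst B h1), (cbpair (cconst (S (encode c))) (cbpair Query k2)).
    intros x (z0 & Hd & w0 & Hw0 & _).
    destruct (Hg x) as (v & Hv & Hdv & Hsol); [now exists w0|].
    set (X := bpair (fun _ => S (encode c)) (bpair x v)). exists X.
    assert (HA : forall y, computes A (bpair X y) (bpair x y)).
    { intros y. unfold A, X. eauto with computes. }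
    assert (Hrun : forall y, g v y -> exists w w', computes h2 (bpair x y) w /\
      g'' x w /\ computes c (bpair X y) w' /\ dom Hit w' /\
      forall y', Hit w' y' -> exists u, computes h1 (bpair w y') u /\ f'' w u).
    { intros y Hy. destruct (Hsol y Hy) as (w & Hw & Hgw).
      destruct (Hf w (Hd w Hgw)) as (w' & Hw' & Hdw' & Hs'). exists w, w'.
      do 2 (split; [assumption|]). split; [|auto]. unfold c. eauto with computes. }
    (* Entry 0 of a nested pair is entry 0 of its leftmost component, here the tag. *)
    assert (Htag : forall y, bpair X y 0 = S (encode c)) by reflexivity.
    assert (Hdom : forall y, g v y -> dom f' (bpair X y)).
    { intros y Hy. destruct (Hrun y Hy) as (w & w' & _ & _ & Hc & (y' & b & Hb & ->) & _).
      exists (bpair (bpair X y) (fun _ => b)), (fun _ => b). split; [|reflexivity].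
      exists b. split; [|reflexivity]. eapply hit_run; eauto. }
    assert (Hg' : forall z, g' X z -> exists y, g v y /\ z = bpair X y).
    { intros z (t & o & v' & y & E & Hy & ->). exists y. split; [|reflexivity].
      apply bpair_inj in E as [_ E]. apply bpair_inj in E as [_ ->]. exact Hy. }
    split; [unfold X; eauto with computes|]. split.
    + destruct Hdv as (y & Hy). destruct (Hdom y Hy) as (u & Hu). exists u. split.
      * intros z Hz. destruct (Hg' z Hz) as (y' & Hy' & ->). auto.
      * exists (bpair X y). split; [|exact Hu]. now exists (fun _ => S (encode c)), x, v, y.
    + intros u (_ & z & Hz & y' & (b & Hb & ->) & ->).
      destruct (Hg' z Hz) as (y & Hy & ->).
      destruct (Hrun y Hy) as (w & w' & Hw & Hgw & Hc & _ & Hs).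
      destruct (Hs (fun _ => b)) as (r & Hr & Hfr).
      { exists b. split; [|reflexivity]. eapply hit_run_inv; eauto. }
      exists r. split.
      { eapply computes_subst; [|exact Hr]. apply computes_bpair; [|eauto with computes].
        eapply computes_subst; [|exact Hw]. eapply computes_subst; [|apply HA].
        eauto with computes. }
      split; [exact Hd | now exists w].
Qed.

Lemma power_Hit_exists m : exists p, is_power Hit (S m) p.
Proof.
  induction m as [|m [q Hq]]; [now exists Hit|].
  destruct (comp_prod_Hit_exists q) as [p Hp]. now exists p, q.
Qed.

(** Each power is reducible to the next, because [idB] is reducible to [Hit] by the constant query
    0; so the jump of [Hit] is inherited. *)
Lemma jumps_power_Hit m p : is_power Hit (S m) p -> jumps p.
Proof.
  revert p. induction m as [|m IH]; intros p Hp.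
  - simpl in Hp; subst. apply jumps_Hit.
  - destruct Hp as (q & Hq & _ & Hmax).
    apply (jumps_leW (compose idB q)).
    + apply Hmax. exists idB, q. split; [|split; [apply leW_refl | reflexivity]].
      apply leW_codes. exists cleft, Zero. intros x _. exists (fun _ => 0).
      split; [intros n; constructor|]. split.
      * exists (fun _ => 0), 0. split; [now constructor | reflexivity].
      * intros y _. exists x. split; [apply computes_left | reflexivity].
    + assert (Hext : compose idB q = q).
      { apply functional_extensionality; intros x.
        apply functional_extensionality; intros z.
        apply propositional_extensionality. split.
        - intros (_ & y & Hy & ->). exact Hy.
        - intros Hz. split; [intros y _; now exists y | now exists z]. }
      rewrite Hext. eauto.
Qed.

(** * Counting up to [2 ^ M] with [M] jumps *)

Fixpoint prefix (y : baire) (N : nat) : nat :=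
  match N with 0 => 0 | S N => to_nat (prefix y N, y N) end.

Lemma prefix_inj y y' N : prefix y N = prefix y' N -> agree N y y'.
Proof.
  induction N as [|N IH]; simpl; intros E i Hi; [lia|].
  apply to_nat_inj in E. injection E as E1 E2.
  destruct (Nat.eq_dec i N) as [->|]; [exact E2 | apply IH; auto; lia].
Qed.

Definition cprefix : code :=
  Rec Zero (Pair (Comp Snd Snd) (Comp cright (Comp Fst Snd))).

Lemma eval_prefix z y a N :
  eval (bpair z y) cprefix (to_nat (a, N)) (prefix y N).
Proof.
  induction N as [|N IH]; [constructor; constructor|].
  eapply eval_rec_S; [exact IH|]. apply eval_pair.
  - eapply eval_comp; [apply eval_snd_pair | apply eval_snd_pair].
  - eapply eval_comp; [|apply computes_right].
    eapply eval_comp; [apply eval_snd_pair | apply eval_fst_pair].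
Qed.

Section Counter.

Variables (s : problem) (a : baire) (A : nat -> baire -> Prop) (alpha : nat -> baire).
Hypothesis dom_a : dom s a.
Hypothesis A_decr : forall M N b, M <= N -> A N b -> A M b.
Hypothesis A_lim : forall N b, A N b -> dom s b /\ agree N b a.
Hypothesis A_sep :
  forall y, s a y -> exists N, forall b y', A N b -> s b y' -> ~ agree N y' y.
Hypothesis alpha_A : forall N, A N (alpha N).

(* [p] codes a prefix of length [N] of a solution at [a] that is not shared by
   any solution on [A N]. *)
Definition separated (N p : nat) : Prop := exists y, s a y /\ prefix y N = p /\
  forall b y', A N b -> s b y' -> ~ agree N y' y.

(* [0] tells the search to stop. *)
Definition stop (nf N p : nat) : nat :=
  if excluded_middle_informative (nf = 0 \/ separated N p) then 0 else 1.

Variable M : nat.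

(* Row [th > 0] of the instance [inst j kap] holds the point [alpha (kap th)] if
   [th <= j] and the point [a] otherwise, and a flag that drops from [1] to [0]
   at stage [kap th] in the former case.  The table [stop], which need not be
   computable, is stored in row [0]. *)
Definition row (j : nat) (kap : nat -> nat) (th : nat) : baire :=
  if th <=? j then alpha (kap th) else a.

Definition flag (j : nat) (kap : nat -> nat) (th i : nat) : nat :=
  if (th <=? j) && (kap th <=? i) then 0 else 1.

Definition inst (j : nat) (kap : nat -> nat) : baire := fun n =>
  let (th, i) := of_nat n in
  match th with
  | 0 => let (nf, l) := of_nat i in let (N, p) := of_nat l in stop nf N p
  | S _ => to_nat (flag j kap th i, row j kap th i)
  end.

Lemma inst_stop j kap nf N p :
  inst j kap (to_nat (0, to_nat (nf, to_nat (N, p)))) = stop nf N p.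
Proof. unfold inst. now rewrite !cancel_of_to. Qed.

Lemma inst_row j kap th i : 0 < th ->
  inst j kap (to_nat (th, i)) = to_nat (flag j kap th i, row j kap th i).
Proof. unfold inst. rewrite cancel_of_to. destruct th; [lia | reflexivity]. Qed.

(* Binary search for [j]. *)
Fixpoint approx (j m : nat) : nat :=
  match m with
  | 0 => 0
  | S m => let th := approx j m + 2 ^ (M - S m) in
           if th <=? j then th else approx j m
  end.

Lemma approx_bounds j m : j < 2 ^ M -> m <= M ->
  approx j m <= j < approx j m + 2 ^ (M - m).
Proof.
  intros Hj. induction m as [|m IH]; intros Hm.
  - rewrite Nat.sub_0_r. simpl. lia.
  - simpl. replace (M - m) with (S (M - S m)) in IH by lia. simpl in IH.
    destruct (Nat.leb_spec (approx j m + 2 ^ (M - S m)) j); lia.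
Qed.

Lemma approx_full j : j < 2 ^ M -> approx j M = j.
Proof.
  intros Hj. pose proof (approx_bounds j M Hj (le_n M)) as H.
  rewrite Nat.sub_diag in H. simpl in H. lia.
Qed.

(** The instance travels along with the approximation, since every later step of the search reads it
    again. *)
Definition state (j : nat) (kap : nat -> nat) (m : nat) : baire :=
  bpair (inst j kap) (fun _ => approx j m).

Definition phase (l m : nat) : problem := fun x y =>
  exists j kap, j < 2 ^ M /\ x = state j kap l /\ y = state j kap m.

Definition cthreshold (d : nat) : code := Comp (cadd d) (Comp cright Zero).

Lemma eval_threshold x u d n :
  eval (bpair x (fun _ => u)) (cthreshold d) n (u + d).
Proof.
  eapply eval_comp; [|apply eval_add].
  eapply eval_comp; [apply eval_zero | apply computes_right].
Qed.

Definition cflag (d : nat) : code :=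
  Comp Fst (Comp (csubst cleft cleft) (Pair (csubst cleft (cthreshold d)) cid)).

(** Looks for the first stage at which either the flag of the threshold row has dropped or the table
    reports that the prefix of the given solution is separated. *)
Definition csearch (d : nat) : code :=
  Mu (Comp (csubst cleft cleft)
    (Pair Zero (Pair (Comp (cflag d) Snd) (Pair Snd cprefix)))).

Definition cupdate (d : nat) : code :=
  cif (Comp (cflag d) (csearch d)) (csubst cleft (cthreshold d))
      (csubst (csubst cleft cright) Query).

Lemma eval_flag j kap m y d N : 0 < d ->
  eval (bpair (state j kap m) y) (cflag d) N (flag j kap (approx j m + d) N).
Proof.
  intros Hd. eapply eval_comp; [|apply eval_fst_pair].
  eapply eval_comp.
  - apply eval_pair; [|apply eval_id].
    eapply eval_subst; [apply computes_left | apply eval_threshold].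
  - rewrite <- inst_row by lia. unfold state.
    eapply computes_subst; apply computes_left.
Qed.

Lemma row_dom j kap th : dom s (row j kap th).
Proof.
  unfold row. destruct (th <=? j); [|exact dom_a]. now apply (A_lim (kap th)).
Qed.

(** The flag at the stage where the search stops decides whether [th <= j]. If so, the flag drops at
    stage [kap th], and the table cannot stop the search earlier. Otherwise the row is [a], the flag
    never drops, and [A_sep] makes the table stop the search. *)
Lemma eval_update j kap m y d : 0 < d -> s (row j kap (approx j m + d)) y ->
  computes (cupdate d) (bpair (state j kap m) y)
    (fun _ => if approx j m + d <=? j then approx j m + d else approx j m).
Proof.
  intros Hd Hy n. set (th := approx j m + d) in *.
  set (val := fun N => stop (flag j kap th N) N (prefix y N)).
  assert (Hval : forall N, eval (bpair (state j kap m) y)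
    (Comp (csubst cleft cleft)
       (Pair Zero (Pair (Comp (cflag d) Snd) (Pair Snd cprefix))))
    (to_nat (n, N)) (val N)).
  { intros N. unfold val. rewrite <- (inst_stop j kap). eapply eval_comp.
    - repeat apply eval_pair; [apply eval_zero| |apply eval_snd_pair | apply eval_prefix].
      eapply eval_comp; [apply eval_snd_pair | now apply eval_flag].
    - unfold state. eapply computes_subst; apply computes_left. }
  assert (Hex : exists N, val N = 0).
  { unfold val, stop, flag. unfold row in Hy.
    destruct (th <=? j).
    - exists (kap th). rewrite Nat.leb_refl. simpl.
      destruct excluded_middle_informative as [_|H]; [reflexivity | destruct H; auto].
    - destruct (A_sep y Hy) as [N HN]. exists N. simpl.
      destruct excluded_middle_informative as [_|H]; [reflexivity | destruct H].
      right. now exists y. }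
  (* All values before the first zero are 1, so [eval_mu] applies with the constant list 0 of
     predecessors. *)
  assert (Hmin : exists N, val N = 0 /\ forall i, i < N -> val i = 1).
  { destruct Hex as [N0 H0]. induction N0 as [N0 IH] using lt_wf_ind.
    destruct (classic (exists i, i < N0 /\ val i = 0)) as [(i & Hi & Hv)|Hno]; [eauto|].
    exists N0. split; [exact H0|]. intros i Hi.
    assert (Hi0 : val i <> 0) by eauto.
    revert Hi0. unfold val, stop. destruct excluded_middle_informative; congruence. }
  destruct Hmin as (N & HN & Hlt).
  assert (Hflag : flag j kap th N = if th <=? j then 0 else 1).
  { unfold val, stop in HN. unfold flag in *. unfold row in Hy.
    destruct (th <=? j); simpl in *; [|reflexivity].
    destruct (Nat.leb_spec (kap th) N) as [|Hk]; [reflexivity|].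
    (* A stop before stage [kap th] is absurd: [alpha (kap th)] lies in [A N], and its solution [y]
       has the prefix that no solution on [A N] has. *)
    destruct excluded_middle_informative as [[H|(y0 & Hy0 & Hp & Hs)]|]; try discriminate.
    exfalso. apply (Hs (alpha (kap th)) y); auto.
    - apply (A_decr N (kap th)); auto; lia.
    - apply prefix_inj. now symmetry. }
  replace (if th <=? j then th else approx j m)
    with (if flag j kap th N =? 0 then th else approx j m)
    by (rewrite Hflag; now destruct (th <=? j)).
  apply eval_if.
  - eapply eval_comp; [|now apply eval_flag].
    apply eval_mu with (w := fun _ => 0).
    + intros i Hi. rewrite <- (Hlt i Hi). apply Hval.
    + rewrite <- HN. apply Hval.
  - rewrite Hflag. destruct (th <=? j); lia.
  - eapply eval_subst; [apply computes_left | apply eval_threshold].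
  - eapply eval_subst; [|apply (eval_query (fun _ => approx j m))].
    unfold state. eauto with computes.
Qed.

(** One bit of the binary search costs one call of [s], on the row of the current threshold. *)
Lemma phase_step m : leW (phase m (S m)) s.
Proof.
  set (d := 2 ^ (M - S m)).
  assert (Hd : 0 < d) by (pose proof (Nat.pow_nonzero 2 (M - S m)); lia).
  apply leW_codes.
  exists (cbpair (csubst cleft cleft) (cupdate d)),
    (Comp Snd (Comp cleft (Pair (cthreshold d) cid))).
  intros x (z & j & kap & Hj & -> & ->).
  exists (row j kap (approx j m + d)). split; [|split; [apply row_dom|]].
  - intros i. eapply eval_comp; [|apply eval_snd_pair].
    eapply eval_comp; [apply eval_pair; [apply eval_threshold | apply eval_id]|].
    rewrite <- inst_row by lia. apply computes_left.
  - intros y Hy. exists (state j kap (S m)). split.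
    + apply computes_bpair; [|now apply eval_update].
      unfold state. eauto with computes.
    + now exists j, kap.
Qed.

Lemma phase_power m p : is_power s (S m) p -> leW (phase 0 (S m)) p.
Proof.
  revert p. induction m as [|m IH]; intros p Hp.
  - simpl in Hp; subst. apply phase_step.
  - destruct Hp as (q & Hq & _ & Hmax).
    assert (Hext : phase 0 (S (S m)) = compose (phase (S m) (S (S m))) (phase 0 (S m))).
    { apply functional_extensionality; intros x.
      apply functional_extensionality; intros z.
      apply propositional_extensionality. split.
      - intros (j & kap & Hj & -> & ->). split.
        + intros y (j' & kap' & Hj' & _ & ->). eexists. now exists j', kap'.
        + exists (state j kap (S m)). split; now exists j, kap.
      - intros (_ & y & (j & kap & Hj & -> & ->) & (j' & kap' & Hj' & E & ->)).
        exists j', kap'. split; [exact Hj'|]. split; [|reflexivity].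
        (* The intermediate state contains the instance, and every search starts from approximation
           0, so both descriptions share the initial state. *)
        apply bpair_inj in E as [E _]. unfold state. now rewrite E. }
    rewrite Hext. apply Hmax. eexists _, _.
    split; [apply phase_step|]. split; [now apply IH | reflexivity].
Qed.

(** The flag of row [j] drops, which happens only in rows up to [j']. *)
Lemma inst_inj j kap j' kap' : inst j kap = inst j' kap' -> j <= j'.
Proof.
  intros E. destruct j as [|j]; [lia|].
  pose proof (inst_row (S j) kap (S j) (kap (S j)) (Nat.lt_0_succ j)) as H.
  rewrite E, inst_row in H by lia. apply to_nat_inj in H. injection H as H _.
  unfold flag in H. rewrite !Nat.leb_refl in H.
  destruct (Nat.leb_spec (S j) j'); [assumption | discriminate].
Qed.

(** Row [S j] is switched from [a] to [alpha L], which agrees with [a] below [L], while its flag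
    stays up until stage [L]. Thus the counter can increase arbitrarily late. *)
Lemma inst_limit j kap L : exists kap', agree L (inst (S j) kap') (inst j kap).
Proof.
  exists (fun th => if th <=? j then kap th else L). intros n Hn. unfold inst.
  rewrite <- (cancel_to_of n) in Hn. destruct (of_nat n) as [th i].
  (* This bounds the position [i] within a row by the index [n < L]. *)
  pose proof (to_nat_non_decreasing th i).
  destruct th as [|th]; [reflexivity|].
  assert (E : flag (S j) (fun th => if th <=? j then kap th else L) (S th) i =
              flag j kap (S th) i /\
              row (S j) (fun th => if th <=? j then kap th else L) (S th) i =
              row j kap (S th) i).
  { unfold flag, row. destruct (Nat.leb_spec (S th) j) as [Hle|Hgt].
    - destruct (Nat.leb_spec (S th) (S j)); [auto | lia].
    - destruct (Nat.leb_spec (S th) (S j)); [|auto].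
      destruct (Nat.leb_spec L i); [lia|]. split; [reflexivity|].
      apply (A_lim L); auto. }
  now destruct E as [-> ->].
Qed.

(** From an instance with counter [j], one with [S j] is chosen so close that the rank cannot fall.
    The solution reveals the counter and hence changes, so the rank must grow. This gives a chain of
    [2 ^ M] instances with strictly increasing ranks. *)
Lemma ranked_phase K : ranked K (phase 0 M) -> 2 ^ M <= K.
Proof.
  intros (R & Rex & Rin & Rc).
  assert (Hval : forall j kap c y, R (state j kap 0) c y -> y 1 = j).
  { intros j kap c y HR. apply Rin in HR as [_ (j' & kap' & Hj' & E & ->)].
    apply bpair_inj in E as [E _]. unfold state.
    change 1 with (S (2 * 0)). rewrite bpair_odd, approx_full by assumption.
    pose proof (inst_inj _ _ _ _ E). symmetry in E. pose proof (inst_inj _ _ _ _ E). lia. }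
  assert (Hdom : forall j kap, j < 2 ^ M -> exists c y, R (state j kap 0) c y).
  { intros j kap Hj. apply Rex. exists (state j kap M). now exists j, kap. }
  assert (Hchain : forall j, j < 2 ^ M -> exists kap c y, R (state j kap 0) c y /\ j <= c).
  { induction j as [|j IH]; intros Hj.
    - destruct (Hdom 0 (fun _ => 0) Hj) as (c & y & HR). exists (fun _ => 0), c, y.
      split; [exact HR | lia].
    - destruct IH as (kap & c & y & HR & Hc); [lia|].
      (* Prefixes of length 2 include entry 1, the first entry of the right half of the state, which
         holds [j]. *)
      destruct (Rc _ _ _ HR 2) as [L HL]. destruct (inst_limit j kap L) as [kap' Hk].
      destruct (Hdom (S j) kap' Hj) as (c' & y' & HR'). exists kap', c', y'.
      split; [exact HR'|].
      destruct (HL _ _ _ HR') as [Hle Heq].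
      { apply agree_bpair; [exact Hk | intros i _; reflexivity]. }
      destruct (Nat.eq_dec c' c) as [->|]; [|lia].
      specialize (Heq eq_refl 1 (le_n 2)). apply Hval in HR, HR'. lia. }
  pose proof (Nat.pow_nonzero 2 M).
  destruct (Hchain (2 ^ M - 1)) as (kap & c & y & HR & Hc); [lia|].
  apply Rin in HR as [Hlt _]. lia.
Qed.

End Counter.

(** * Comparison of the two counts *)

Lemma jumps_power_rank s m p K :
  jumps s -> is_power s (S m) p -> ranked K p -> 2 ^ S m <= K.
Proof.
  intros (a & A & Ha & Hne & Hdec & Hlim & Hsep) Hp HK.
  set (alpha := fun N => proj1_sig (constructive_indefinite_description _ (Hne N))).
  assert (HA : forall N, A N (alpha N)).
  { intros N. unfold alpha. now destruct constructive_indefinite_description. }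
  (* The search is given as many bits as the power has factors, that is, [M] is [S m]. *)
  eapply ranked_phase; eauto.
  eapply ranked_leW; [|exact HK]. eapply phase_power; eauto.
Qed.

Theorem theorem1p8 :
  forall n : nat, 2 <= n ->
    exists f : problem, has_root n f /\ ~ has_root (S n) f.
Proof.
  intros [|n] Hn; [lia|]. destruct (power_Hit_exists n) as [f Hf]. exists f. split.
  - exists Hit, f. split; [exact Hf|]. split; apply leW_refl.
  - intros (s & p & Hp & Hfp & Hpf).
    assert (Hs : jumps s).
    { apply (jumps_power s (S n) p Hp). apply (jumps_leW f p Hfp).
      now apply (jumps_power_Hit n). }
    assert (Hr : ranked (2 ^ S n) p).
    { apply (ranked_leW _ p f Hpf). now apply (ranked_power 2 Hit n f ranked_Hit). }
    pose proof (jumps_power_rank s (S n) p _ Hs Hp Hr) as Hle.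
    rewrite Nat.pow_succ_r' in Hle. pose proof (Nat.pow_nonzero 2 (S n)). lia.
Qed.
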